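(* Let $(K,\nu)$ be a henselian valued field with $\operatorname{char} K=p>0$ and let $(K(\theta)|K,\nu)$ be a minimal purely wild extension, where the generator $\theta$ is such that its minimal polynomial over $K$ has the form $f(X)=\mathfrak{A}(X)-c$ with $c\in K$ and $$\mathfrak{A}(X)=\sum_{i=0}^{n} a_i X^{p^i}\in\mathcal{O}_K[X].$$ Suppose that $\nu a_0=\nu a_n=0$ and that $K\nu$ is not $\mathfrak{A}\nu$-closed. Then $(K,\nu)$ does not admit a unique maximal purely wild extension.
   Context: Valuations are Krull valuations of arbitrary rank, written additively. For a valued field $(K,\nu)$: $\mathcal{O}_K$ is the valuation ring, $\nu K$ the value group, $K\nu$ the residue field; for $g\in\mathcal{O}_K[X]$, $g\nu\in K\nu[X]$ is the polynomial obtained by reducing coefficients. $(K,\nu)$ is henselian if $\nu$ extends uniquely to the algebraic closure $K^{\mathrm{ac}}$; every algebraic extension of $K$ carries this unique extension, again denoted $\nu$. For henselian $(K,\nu)$ with $\operatorname{char}K\nu=p>0$, an algebraic extension $(L|K,\nu)$ is purely wild if $\nu L/\nu K$ is a $p$-group and $L\nu|K\nu$ is purely inseparable. A purely wild extension is minimal if it admits no proper nontrivial subextension. A maximal purely wild extension of $K$ is a purely wild extension (inside $K^{\mathrm{ac}}$) not properly contained in another purely wild extension of $K$. ''$(K,\nu)$ does not admit a unique maximal purely wild extension'' means that there exist two maximal purely wild extensions of $(K,\nu)$ that are not isomorphic over $K$ by a valuation preserving isomorphism. A field $k$ is not $g$-closed, for $g\in k[X]$, if $g(k)\subsetneq k$,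 i.e. there is $d\in k$ such that $g(X)-d$ has no root in $k$. *)

(* Defs.v *)
From HB Require Import structures.
From mathcomp Require Import all_boot all_order all_algebra.
From mathcomp Require Import boolp.

Set Implicit Arguments.
Unset Strict Implicit.
Unset Printing Implicit Defensive.

Import Order.TTheory GRing.Theory Num.Theory.
Local Open Scope ring_scope.
Local Open Scope quotient_scope.

HB.mixin Record isOrderedAbGroup (G : Type) of Num.POrderedZmodule G := {
  oag_le_total : forall x y : G, (x <= y) || (y <= x);
  oag_leD2l : forall z x y : G, x <= y -> z + x <= z + y
}.

(* Totally ordered abelian groups, with no condition on the rank. *)
#[short(type="oagType")]
HB.structure Definition OrderedAbGroup :=
  {G of isOrderedAbGroup G & Num.POrderedZmodule G}.

(* [option G] stands for G with an infinity: [None] is the infinite value. *)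
Section Infinity.
Variable G : oagType.
Implicit Types a b : option G.

Definition ole a b : bool :=
  match a, b with
  | _, None => true
  | None, Some _ => false
  | Some x, Some y => x <= y
  end.

Definition omin a b := if ole a b then a else b.

Definition oadd a b : option G :=
  match a, b with
  | Some x, Some y => Some (x + y)
  | _, _ => None
  end.

Lemma ole_refl a : ole a a.
Proof. by case: a => /=. Qed.

Lemma ole_trans b a c : ole a b -> ole b c -> ole a c.
Proof. by case: a b c => [x|] [y|] [z|] //=; exact: le_trans. Qed.

Lemma ole_total a b : ole a b || ole b a.
Proof. by case: a b => [x|] [y|] //=; exact: oag_le_total. Qed.

Lemma oag_ltNge (x y : G) : (x < y) = ~~ (y <= x).
Proof.
rewrite lt_leAnge; case: (boolP (y <= x)) => yx; rewrite ?andbF //= andbT.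
by have := oag_le_total x y; rewrite (negbTE yx) orbF.
Qed.

Lemma oag_addr_ge0 (x y : G) : 0 <= x -> 0 <= y -> 0 <= x + y.
Proof.
move=> x0 y0; apply: le_trans x0 _.
by have := oag_leD2l x _ _ y0; rewrite addr0.
Qed.

Lemma oag_addr_gt0 (x y : G) : 0 <= x -> 0 < y -> 0 < x + y.
Proof.
move=> x0 y0; apply: le_lt_trans x0 _; rewrite lt_neqAle.
have := oag_leD2l x _ _ (ltW y0); rewrite addr0 => ->; rewrite andbT.
by rewrite -{1}(addr0 x) (inj_eq (addrI x)) eq_sym gt_eqF.
Qed.

End Infinity.

(* The group need not be the exact image of v; the value group is
   [value_group] below. *)
Record valuation (F : fieldType) := Valuation {
  vgrp : oagType;
  vval :> F -> option vgrp;
  vval_None : forall x, vval x = None <-> x = 0;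
  vvalM : forall x y, vval (x * y) = oadd (vval x) (vval y);
  vvalD : forall x y, ole (omin (vval x) (vval y)) (vval (x + y))
}.

Section ValuationRing.
Variables (F : fieldType) (v : valuation F).

Lemma vval0 : v 0 = None. Proof. exact/vval_None. Qed.

Lemma vval1 : v 1 = Some 0.
Proof.
have := vvalM v 1 1; rewrite mulr1; case E: (v 1) => [x|] /=.
  by case=> /(congr1 (fun y => y - x)); rewrite subrr addrK => <-.
by move/vval_None/eqP: E; rewrite oner_eq0.
Qed.

Lemma oag_double0 (x : vgrp v) : x + x = 0 -> x = 0.
Proof.
move=> xx; apply/eqP; case/orP: (oag_le_total 0 x) => x0; rewrite eq_le x0 /= ?andbT.
  by have := oag_leD2l x _ _ x0; rewrite addr0 xx.
by have := oag_leD2l x _ _ x0; rewrite addr0 xx => ->.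
Qed.

Lemma vvalN1 : v (- 1) = Some 0.
Proof.
have := vvalM v (- 1) (- 1); rewrite mulrNN mulr1 vval1.
by case: (v _) => [x|] //= [] /esym/oag_double0 ->.
Qed.

Lemma vvalN x : v (- x) = v x.
Proof. by rewrite -mulN1r vvalM vvalN1; case: (v x) => [y|] //=; rewrite add0r. Qed.

Lemma vval_ge_add a x y : ole a (v x) -> ole a (v y) -> ole a (v (x + y)).
Proof.
move=> ax ay; apply: ole_trans (vvalD v x y).
by rewrite /omin; case: ifP.
Qed.

Definition vring_pred : {pred F} := fun x => ole (Some 0) (v x).

Lemma vring_subring : subring_closed vring_pred.
Proof.
split=> [|x y xO yO|x y].
- by rewrite unfold_in /vring_pred vval1 /=.
- by apply: vval_ge_add; rewrite ?vvalN.
rewrite !unfold_in /vring_pred vvalM.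
by case: (v x) (v y) => [a|] [b|] //=; exact: oag_addr_ge0.
Qed.

HB.instance Definition _ := GRing.isSubringClosed.Build F vring_pred vring_subring.

Definition vring : Type := {x : F | x \in vring_pred}.

HB.instance Definition _ := [isSub of vring for @sval _ _].
HB.instance Definition _ := [Choice of vring by <:].
HB.instance Definition _ := [SubChoice_isSubComNzRing of vring by <:].

Definition vmax : {pred vring} := fun x => ~~ ole (v (val x)) (Some 0).

Lemma vmax_idealr : idealr_closed vmax.
Proof.
split.
- by rewrite unfold_in /vmax rmorph0 vval0.
- by rewrite unfold_in /vmax rmorph1 vval1 /= negbK.
move=> a x y; rewrite !unfold_in /vmax rmorphD rmorphM /=.
have := valP a; rewrite unfold_in /vring_pred => aO x0 y0.
have ax0 : ~~ ole (v (val a * val x)) (Some 0).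
  rewrite vvalM; move: aO x0; case: (v (val a)) (v (val x)) => [b|] [c|] //=.
  by rewrite -!oag_ltNge; exact: oag_addr_gt0.
apply: contra (ax0) => s0; have := vvalD v (val a * val x) (val y).
move/ole_trans => /(_ _ s0); rewrite /omin; case: ifP => // _.
by rewrite (negbTE y0).
Qed.

HB.instance Definition _ := isIdealr.Build vring vmax vmax_idealr.

Definition resfield : Type := {ideal_quot vmax}.

HB.instance Definition _ := GRing.ComNzRing.on resfield.

Definition residue (x : vring) : resfield := \pi_({ideal_quot vmax}) x.

Lemma residue_is_zmod_morphism : zmod_morphism residue.
Proof. move=> x y; exact: (raddfB \pi_({ideal_quot vmax})). Qed.
Lemma residue_is_monoid_morphism : monoid_morphism residue.
Proof.
split; first exact: (rmorph1 \pi_({ideal_quot vmax})).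
by move=> x y; exact: (rmorphM \pi_({ideal_quot vmax})).
Qed.
HB.instance Definition _ :=
  GRing.isZmodMorphism.Build vring resfield residue residue_is_zmod_morphism.
HB.instance Definition _ :=
  GRing.isMonoidMorphism.Build vring resfield residue residue_is_monoid_morphism.

Lemma residue_eq0 x : (residue x == 0) = (x \in vmax).
Proof.
rewrite -(rmorph0 residue) /residue; have := Quotient.idealrBE vmax x 0.
by rewrite subr0 => <-.
Qed.

Lemma residueP (z : resfield) : residue (repr z) = z.
Proof. exact: (reprK (z : {ideal_quot vmax})). Qed.

Definition resinv (z : resfield) : resfield :=
  if z == 0 then 0 else residue (insubd (0 : vring) (val (repr z))^-1).

Lemma resmulVf (z : resfield) : z != 0 -> resinv z * z = 1.
Proof.
move=> z0; rewrite /resinv (negbTE z0).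
move: (z0); rewrite -(residueP z) residue_eq0 residueP unfold_in /vmax negbK.
set x := repr z => x0; have := valP x; rewrite unfold_in /vring_pred => xO.
have vx : v (val x) = Some 0.
  move: xO x0; case: (v (val x)) => [b|] //= b0 b0'; congr Some.
  by apply: le_anti; rewrite b0 b0'.
have xn0 : val x != 0 by apply/eqP => x0'; have := vx; rewrite x0' vval0.
have vx' : v (val x)^-1 = Some 0.
  have := vvalM v (val x) (val x)^-1; rewrite divff // vval1 vx.
  by case: (v _) => [b|] //= [->]; rewrite add0r.
rewrite -[X in _ * X](residueP z) -rmorphM -[RHS](rmorph1 residue).
congr residue; apply: val_inj; rewrite rmorphM /= val_insubd.
by rewrite unfold_in /vring_pred vx' /= lexx mulVf.
Qed.

Lemma resinv0 : resinv 0 = 0. Proof. by rewrite /resinv eqxx. Qed.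

HB.instance Definition _ := GRing.ComNzRing_isField.Build resfield resmulVf resinv0.

(* The value group and the residue field of a subset L of F (in practice a
   subfield), inside those of F. *)
Definition value_group (L : {pred F}) (g : vgrp v) : Prop :=
  exists2 x, x \in L & v x = Some g.

Definition residue_field (L : {pred F}) (z : resfield) : Prop :=
  exists2 x : vring, val x \in L & z = residue x.

End ValuationRing.

Arguments residue {F} v x.
Arguments value_group {F} v L g.
Arguments residue_field {F} v L z.

Definition poly_closed (k : nzRingType) (g : {poly k}) : Prop :=
  forall d, exists x, g.[x] = d.

(* The two sides may have different value groups; this says that v1 x |-> v2 x
   is a well-defined isomorphism of ordered groups between the images. *)
Definition val_equiv (F : Type) (G1 G2 : oagType)
    (v1 : F -> option G1) (v2 : F -> option G2) : Prop :=
  forall x y, ole (v1 x) (v1 y) = ole (v2 x) (v2 y).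

Section SubfieldType.
Variables (F : fieldType) (L : divringClosed F).

Definition subfield_type : Type := {x : F | x \in L}.

HB.instance Definition _ := [isSub of subfield_type for @sval _ _].
HB.instance Definition _ := [Choice of subfield_type by <:].
HB.instance Definition _ := [SubChoice_isSubIntegralDomain of subfield_type by <:].
HB.instance Definition _ := [SubIntegralDomain_isSubField of subfield_type by <:].

End SubfieldType.

(* Throughout, iota embeds K in an overfield E (an algebraic closure of K in the
   applications), and subextensions of E|K are subfields of E containing the
   image of K. *)
Section Extensions.
Variables (K E : fieldType) (iota : {rmorphism K -> E}).

Definition base_field : {pred E} := fun y => `[< exists x, y = iota x >].

Lemma base_field_divring : divring_closed base_field.
Proof.
split=> [|y z|y z]; rewrite !unfold_in.
- by apply/asboolP; exists 1; rewrite rmorph1.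
- move=> /asboolP[x ->] /asboolP[x' ->]; apply/asboolP.
  by exists (x - x'); rewrite rmorphB.
move=> /asboolP[x ->] /asboolP[x' ->]; apply/asboolP.
by exists (x / x'); rewrite fmorph_div.
Qed.

HB.instance Definition _ :=
  GRing.isDivringClosed.Build E base_field base_field_divring.

Definition adjoin (theta : E) : {pred E} := fun y =>
  `[< forall M : divringClosed E,
        {subset base_field <= M} -> theta \in M -> y \in M >].

Lemma adjoin_divring theta : divring_closed (adjoin theta).
Proof.
split=> [|y z|y z]; rewrite !unfold_in.
- by apply/asboolP => M _ _; exact: rpred1.
- move=> /asboolP yP /asboolP zP; apply/asboolP => M KM tM.
  by apply: rpredB; [exact: yP | exact: zP].
move=> /asboolP yP /asboolP zP; apply/asboolP => M KM tM.
by apply: rpred_div; [exact: yP | exact: zP].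
Qed.

HB.instance Definition _ theta :=
  GRing.isDivringClosed.Build E (adjoin theta) (adjoin_divring theta).

(* A generator of the ideal of polynomials over K vanishing at theta. It is not
   required to be monic. *)
Definition is_minpoly (theta : E) (f : {poly K}) : Prop :=
  f != 0 /\ forall g : {poly K}, root (map_poly iota g) theta = (f %| g).

Definition val_extends (v : valuation K) (w : valuation E) : Prop :=
  val_equiv v (w \o iota).

Definition extends_uniquely (v : valuation K) : Prop :=
  (exists w, val_extends v w) /\
  (forall w1 w2, val_extends v w1 -> val_extends v w2 -> val_equiv w1 w2).

Variables (p : nat) (w : valuation E).

(* E|K is assumed algebraic wherever this is used. The last two conditions say
   that wL/wK is a p-group and that the residue extension Lw|Kw, whose
   characteristic is p, is purely inseparable. *)
Definition purely_wild (L : divringClosed E) : Prop :=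
  [/\ {subset base_field <= L},
      forall g, value_group w L g ->
        exists m, value_group w base_field (g *+ (p ^ m))
    & forall z, residue_field w L z ->
        exists m, residue_field w base_field (z ^+ (p ^ m))].

Definition minimal_purely_wild (L : divringClosed E) : Prop :=
  purely_wild L /\
  forall M : divringClosed E, {subset base_field <= M} -> {subset M <= L} ->
    M =i base_field \/ M =i L.

Definition maximal_purely_wild (L : divringClosed E) : Prop :=
  purely_wild L /\
  forall M : divringClosed E, purely_wild M -> {subset L <= M} -> M =i L.

Definition val_isomorphic (L1 L2 : divringClosed E) : Prop :=
  exists sigma : {rmorphism subfield_type L1 -> subfield_type L2},
    [/\ bijective sigma,
        forall (x : K) (u : subfield_type L1),
          val u = iota x -> val (sigma u) = iota x
      & forall u, w (val (sigma u)) = w (val u)].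

End Extensions.

Definition algebraic_ext (K E : fieldType) (iota : {rmorphism K -> E}) : Prop :=
  forall z, algebraicOver iota z.

(* To be used with iota an algebraic closure of K, i.e. [algebraic_ext iota];
   uniqueness is up to equivalence of valuations. *)
Definition henselian (K : fieldType) (v : valuation K)
    (Kac : closedFieldType) (iota : {rmorphism K -> Kac}) : Prop :=
  extends_uniquely iota v.

Section AdditivePolynomial.
Variables (R : nzRingType) (p n : nat) (a : 'I_n.+1 -> R).

Definition additive_poly : {poly R} := \sum_(i < n.+1) a i *: 'X^(p ^ i).

End AdditivePolynomial.

(* Main.v *)
From HB Require Import structures.
Require Import Defs.
From mathcomp Require Import all_boot all_order all_algebra separable.
From mathcomp Require Import boolp classical_sets.

Set Implicit Arguments.
Unset Strict Implicit.
Unset Printing Implicit Defensive.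

Import GRing.Theory.
Local Open Scope ring_scope.

(** Write A for the additive polynomial over the valuation ring O, and pick d in
    O whose residue is not a value of the reduction of A on the residue field of
    K.  Let xi be a root of A - d in the algebraic closure E.  Both theta and
    theta + xi generate purely wild extensions of K; extend them to maximal
    ones L1 and L2.  An isomorphism from L1 to L2 over K would give a root
    theta' of A - c in L2, and theta + xi - theta' would be a root of A - d in
    the purely wild extension L2.  Since v a_0 = 0, the reduction of A - d is
    separable, so such a root lies in K (lemma [purely_wild_root]); its residue
    contradicts the choice of d.

    The substance is that K(theta + xi) is purely wild ([purely_wild_twist]).
    Instead of Hensel's lemma and ramification theory, the proof uses the
    endomorphisms s of E over K.  By the uniqueness of the extension of v, they
    all preserve the valuation w of E up to equivalence ([endo_val]), and they
    are plentiful, because E is algebraic over K and algebraically closed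
    ([conjugate_endo]).  Two facts are played against each other:
    - if u is integral in a purely wild extension, then s u and u have the
      same residue, because a power with exponent p^m of the residue of u comes
      from K ([purely_wild_endo_res]);
    - the conjugates of xi over K have pairwise distinct residues
      ([add_poly_res_inj]).
    Let m be the degree of xi over K.  Together they show that for a polynomial
    U of degree less than m over a purely wild extension, the value of U.[xi] is
    the least value of a coefficient ([val_horner]).  In particular xi still
    has degree m over K(theta), and by additivity of A every conjugate x of xi is
    the image of xi under some s that fixes theta + xi ([compensating_endo]).
    Elements of K(theta + xi) have the form U.[xi] with U over K(theta).
    Their values therefore lie in the value group of K(theta), and if such an element
    is integral, it is also congruent to U.[x] for all conjugates x of xi, which
    forces it to be congruent to the constant coefficient of U. *)

(** * Minimal polynomials and partial endomorphisms *)

Lemma is_minpoly_exists (F E : fieldType) (phi : {rmorphism F -> E}) (t : E) :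
  algebraicOver phi t -> exists h, is_minpoly phi t h.
Proof.
case=> q q0 qt.
pose P n := `[< exists h, [/\ h != 0, root (map_poly phi h) t & size h = n] >].
have exP : exists n, P n by exists (size q); apply/asboolP; exists q.
case: (ex_minnP exP) => m /asboolP[h [h0 ht hm]] min_m.
exists h; split=> // g; apply/idP/idP => [gt|/dvdpP[k ->]]; last first.
  by rewrite rmorphM rootM ht orbT.
have ght : root (map_poly phi (g %% h)) t.
  move: gt; rewrite {1}(divp_eq g h) rmorphD rmorphM rootE hornerD hornerM.
  by rewrite (rootP ht) mulr0 add0r.
rewrite /dvdp; apply: contraT => gh0.
have /min_m : P (size (g %% h)) by apply/asboolP; exists (g %% h).
by rewrite -hm leqNgt ltn_modpN0.
Qed.

(** Irreducibility of minimal polynomials, in the form in which it yields inverses in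
    a simple extension. *)
Lemma is_minpoly_bezout (F E : fieldType) (phi : {rmorphism F -> E}) (t : E)
    (h q : {poly F}) :
  is_minpoly phi t h -> (map_poly phi q).[t] != 0 ->
  exists r s, r * q + s * h = 1.
Proof.
case=> h0 hP qt.
have ht : root (map_poly phi h) t by rewrite hP.
have /dvdpP[k hk] := dvdp_gcdr q h.
have gt : ~~ root (map_poly phi (gcdp q h)) t.
  rewrite hP; apply: contra qt => hg.
  by rewrite -rootE hP (dvdp_trans hg) ?dvdp_gcdl.
have hdk : h %| k.
  by move: ht; rewrite {1}hk rmorphM rootM (negPf gt) orbF hP.
have /Bezout_eq1_coprimepP[[r s] /= rs] : coprimep q h.
  rewrite /coprimep; have k0 : k != 0 by apply: contraNneq h0 => k0; rewrite hk k0 mul0r.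
  have g0 : gcdp q h != 0 by rewrite gcdp_eq0 (negPf h0) andbF.
  have := dvdp_leq k0 hdk; rewrite {1}hk size_mul //.
  have := g0; have := k0; rewrite -!size_poly_gt0.
  case: (size k) (size (gcdp q h)) => [|a] [|[|b]] //= _ _.
  by rewrite addnS addnS ltnS ltnNge leq_addr.
by exists r, s.
Qed.

Section PartialEndomorphisms.
Variable E : fieldType.
Implicit Types G : set (E * E).

(** Partial endomorphisms are encoded by their graphs, so that the union of a
    chain is again a partial endomorphism without any gluing of functions.
    Closure under division makes the domain a subfield. *)
Definition partial_endo G : Prop :=
  [/\ G (1, 1),
      forall x y x' y', G (x, y) -> G (x', y') -> G (x - x', y - y'),
      forall x y x' y', G (x, y) -> G (x', y') -> G (x / x', y / y')
    & forall y, G (0, y) -> y = 0].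

Lemma partial_endo_fun G x y y' :
  partial_endo G -> G (x, y) -> G (x, y') -> y = y'.
Proof.
case=> _ GB _ G0 Gy Gy'; apply/eqP; rewrite -subr_eq0; apply/eqP/G0.
by rewrite -(subrr x); exact: GB.
Qed.

Lemma partial_endo_adjoin (F : fieldType) (phi psi : {rmorphism F -> E})
    (t t' : E) (h : {poly F}) :
  is_minpoly phi t h -> root (map_poly psi h) t' ->
  partial_endo [set z | exists P,
    z = ((map_poly phi P).[t], (map_poly psi P).[t'])].
Proof.
move=> hmin ht'.
have kill P : (map_poly phi P).[t] = 0 -> (map_poly psi P).[t'] = 0.
  move=> /rootP; rewrite hmin.2 => /dvdpP[k ->].
  by rewrite rmorphM hornerM (rootP ht') mulr0.
have ht : (map_poly phi h).[t] = 0 by apply/rootP; rewrite hmin.2.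
split=> [|x y x' y'|x y x' y'|y].
- by exists 1; rewrite !rmorph1 !hornerC.
- by case=> P [-> ->] [Q [-> ->]]; exists (P - Q); rewrite !rmorphB !hornerD !hornerN.
- case=> P [-> ->] [Q [-> ->]].
  have [Q0|Q0] := eqVneq (map_poly phi Q).[t] 0.
    by exists 0; rewrite Q0 (kill _ Q0) !invr0 !mulr0 !rmorph0 !horner0.
  have [r [s rs]] := is_minpoly_bezout hmin Q0.
  have inv (chi : {rmorphism F -> E}) z : (map_poly chi h).[z] = 0 ->
      (map_poly chi Q).[z]^-1 = (map_poly chi r).[z].
    move=> hz; have /(congr1 (fun p => (map_poly chi p).[z])) := rs.
    rewrite rmorphD !rmorphM rmorph1 hornerD !hornerM hz mulr0 addr0 hornerC.
    move=> e; have Qz : (map_poly chi Q).[z] != 0.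
      by apply/eqP => z0; move: e; rewrite z0 mulr0 => /esym/eqP; rewrite oner_eq0.
    by apply: (mulIf Qz); rewrite mulVf.
  exists (P * r); rewrite !rmorphM !hornerM (inv phi t ht) (inv psi t') //.
  exact/rootP.
- by case=> P [/esym/kill <- ->].
Qed.

End PartialEndomorphisms.

(** * Extension of embeddings to an algebraic closure *)

(** Zorn's lemma for properties that, like being a field, fail for the empty set:
    only nonempty chains above a given set have to be bounded. *)
Lemma Zorn_above (T : Type) (P : set T -> Prop) (A0 : set T) :
  P A0 ->
  (forall F : set (set T), (exists X, F X) -> (forall X, F X -> P X) ->
     (forall X, F X -> subset A0 X) -> total_on F subset ->
     P (fun x => exists2 X, F X & X x)) ->
  exists M, [/\ P M, subset A0 M & forall B, P B -> subset M B -> subset B M].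
Proof.
move=> PA0 Pchain.
(* Adjoining A0 to every set makes the empty chain harmless. *)
have [F FP Ftot|A [PA maxA]] := @Zorn_bigcup T (fun A => P (A0 `|` A)%classic).
  have [[X0 FX0]|F0] := pselect (exists X, F X); last first.
    rewrite (_ : (A0 `|` _)%classic = A0) //; apply/seteqP; split=> x; last by left.
    by case=> // -[X FX _]; case: F0; exists X.
  have /Pchain := ex_intro (fun Y => exists2 X, F X & Y = (A0 `|` X)%classic)
    (A0 `|` X0)%classic (ex_intro2 _ _ X0 FX0 erefl).
  rewrite (_ : (A0 `|` _)%classic = (fun x => exists2 X,
      (exists2 X', F X' & X = (A0 `|` X')%classic) & X x)).
    apply.
    - by move=> _ [X FX ->]; exact: FP.
    - by move=> _ [X FX ->]; left.
    - move=> _ _ [X FX ->] [Y FY ->].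
      by case: (Ftot X Y FX FY) => XY; [left|right]; move=> x [xA|xX];
        [left|right; exact: XY|left|right; exact: XY].
  apply/seteqP; split=> x.
    case=> [xA|[X FX xX]]; last by exists (A0 `|` X)%classic; [exists X|right].
    by exists (A0 `|` X0)%classic; [exists X0|left].
  by case=> _ [X FX ->] [xA|xX]; [left|right; exists X].
exists (A0 `|` A)%classic; split=> // B PB AB; apply: contrapT => BA.
apply: (maxA B); last first.
  by rewrite (_ : (A0 `|` B)%classic = B) //; apply/setUidPr => x xA; apply: AB; left.
by split=> [x xA|BA']; [apply: AB; right|apply: BA => x /BA'; right].
Qed.

Lemma divring_of_prop (E : fieldType) (D : E -> Prop) :
  D 1 -> (forall x y, D x -> D y -> D (x - y)) ->
  (forall x y, D x -> D y -> D (x / y)) ->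
  exists L : divringClosed E, forall x, (x \in L) <-> D x.
Proof.
move=> D1 DB DV; pose L : {pred E} := fun x => `[< D x >].
have LP : divring_closed L.
  by split=> [|x y|x y]; rewrite !unfold_in; first exact/asboolP;
    move=> /asboolP Dx /asboolP Dy; apply/asboolP; [exact: DB|exact: DV].
pose L' : divringClosed E := HB.pack L (GRing.isDivringClosed.Build E L LP).
by exists L' => x; split=> [/asboolP|Dx] //; exact/asboolP.
Qed.

Section Extension.
Variables (K : fieldType) (E : closedFieldType) (iota : {rmorphism K -> E}).
Hypothesis alg : algebraic_ext iota.

(** A maximal partial endomorphism is total: an element t outside its domain is
    algebraic over it, and can be sent to any root of the image of its minimal
    polynomial. *)
Lemma partial_endo_extend (G0 : set (E * E)) :
  partial_endo G0 -> (forall k, G0 (iota k, iota k)) ->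
  exists s : {rmorphism E -> E}, forall x y, G0 (x, y) -> s x = y.
Proof.
move=> PG0 G0K; have [|G [PG G0G maxG]] := Zorn_above PG0.
  move=> F [X0 FX0] FP FG0 Ftot.
  have join z z' : (exists2 X, F X & X z) -> (exists2 X, F X & X z') ->
      exists X, [/\ F X, X z & X z'].
    move=> [X FX Xz] [Y FY Yz]; case: (Ftot X Y FX FY) => XY.
      by exists Y; split=> //; exact: XY.
    by exists X; split=> //; exact: XY.
  split=> [|x y x' y' Gx Gx'|x y x' y' Gx Gx'|y [X FX Xy]].
  - by exists X0 => //; case: (FP _ FX0).
  - by have [X [FX Xx Xx']] := join _ _ Gx Gx'; exists X => //; case: (FP _ FX) => _ + _ _; apply.
  - by have [X [FX Xx Xx']] := join _ _ Gx Gx'; exists X => //; case: (FP _ FX) => _ _ + _; apply.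
  - by case: (FP _ FX) => _ _ _; apply.
have [G1 GB GV _] := PG.
have [||x x' [y Gy] [y' Gy']|D DP] := @divring_of_prop E (fun x => exists y, G (x, y)).
- by exists 1.
- by move=> x x' [y Gy] [y' Gy']; exists (y - y'); exact: GB.
- by exists (y / y'); exact: GV.
have /choice[sig0 sigG] (u : subfield_type D) : exists y, G (val u, y).
  exact/DP/valP.
have sigB : zmod_morphism sig0.
  move=> u u'; apply: (partial_endo_fun PG (sigG _)); rewrite rmorphB.
  exact: (GB _ _ _ _ (sigG u) (sigG u')).
have sigM : monoid_morphism sig0.
  split; first by apply: (partial_endo_fun PG (sigG _)); rewrite rmorph1.
  move=> u u'; apply: (partial_endo_fun PG (sigG _)); rewrite rmorphM.
  have := GV _ _ _ _ (sigG u) (GV _ _ _ _ G1 (sigG u')).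
  by rewrite !div1r !invrK.
pose sig : {rmorphism subfield_type D -> E} := HB.pack sig0
  (GRing.isZmodMorphism.Build _ _ sig0 sigB) (GRing.isMonoidMorphism.Build _ _ sig0 sigM).
have Dtotal t : exists y, G (t, y).
  have : algebraicOver (val : subfield_type D -> E) t.
    have [q q0 qt] := alg t.
    have DK k : iota k \in D by apply/DP; exists (iota k); exact/G0G/G0K.
    pose q' : {poly subfield_type D} := map_poly (fun k => Sub (iota k) (DK k)) q.
    have q'E : map_poly val q' = map_poly iota q.
      apply/polyP => i; rewrite !coef_map_id0 ?rmorph0 //.
      by apply: val_inj; rewrite /= rmorph0.
    exists q'; last by rewrite q'E.
    by rewrite -(map_poly_eq0 (val : {rmorphism subfield_type D -> E})) q'E map_poly_eq0.
  move=> /is_minpoly_exists[h hmin].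
  have /closed_rootP[t' ht'] : size (map_poly sig h) != 1%N.
    rewrite size_map_poly; have [h0 hP] := hmin.
    apply/negP => /size_poly1P[c c0 hc].
    have := dvdpp h; rewrite -hP hc map_polyC rootC.
    by rewrite fmorph_eq0 (negPf c0).
  exists t'; apply: (maxG _ (partial_endo_adjoin hmin ht')); last first.
    by exists 'X; rewrite !map_polyX !hornerX.
  move=> [x y] Gxy; have Dx : x \in D by apply/DP; exists y.
  exists (Sub x Dx)%:P; rewrite !map_polyC !hornerC /=; congr pair.
  apply: (partial_endo_fun PG Gxy); exact: (sigG (Sub x Dx)).
have [s0 sG] := choice Dtotal.
have sB : zmod_morphism s0.
  by move=> x y; apply: (partial_endo_fun PG (sG _)); exact: GB.
have sM : monoid_morphism s0.
  split; first exact: (partial_endo_fun PG (sG _)).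
  move=> x y; apply: (partial_endo_fun PG (sG _)).
  by have := GV _ _ _ _ (sG x) (GV _ _ _ _ G1 (sG y)); rewrite !div1r !invrK.
pose s : {rmorphism E -> E} := HB.pack s0
  (GRing.isZmodMorphism.Build _ _ s0 sB) (GRing.isMonoidMorphism.Build _ _ s0 sM).
by exists s => x y /G0G Gxy; exact: (partial_endo_fun PG (sG x)).
Qed.

(** Embeddings of F extend to simple extensions by sending a generator to any
    conjugate, and from there to the algebraically closed field E.  Taking
    for [psi] the restriction of an endomorphism already constructed lets such
    choices be made one generator at a time. *)
Lemma conjugate_endo (F : fieldType) (phi psi : {rmorphism F -> E})
    (t t' : E) (h : {poly F}) :
  (forall k, exists2 x, phi x = iota k & psi x = iota k) ->
  is_minpoly phi t h -> root (map_poly psi h) t' ->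
  exists s : {rmorphism E -> E},
    [/\ forall x, s (phi x) = psi x, forall k, s (iota k) = iota k & s t = t'].
Proof.
move=> FK hmin ht'.
have [|s sP] := partial_endo_extend (partial_endo_adjoin hmin ht').
  move=> k; have [x xk xk'] := FK k; exists x%:P.
  by rewrite !map_polyC !hornerC; congr pair; apply: esym.
have sF x : s (phi x) = psi x.
  by apply: sP; exists x%:P; rewrite !map_polyC !hornerC.
exists s; split=> // [k|]; first by have [x <- /esym] := FK k; rewrite -sF.
by apply: sP; exists 'X; rewrite !map_polyX !hornerX.
Qed.

End Extension.

(** * Residues, and the action of endomorphisms on them *)

Section Residues.
Variables (F : fieldType) (w : valuation F).
Local Notation O := (vring_pred w).

(** Residue map made total by the default value 0 outside the valuation ring.
    For integral x and y, [res x = res y] says that x and y are congruent modulo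
    the maximal ideal. *)
Definition res (x : F) : resfield w := residue w (insubd (0 : vring w) x).

Lemma res_val (x : vring w) : res (val x) = residue w x.
Proof. by rewrite /res valKd. Qed.

Lemma integral_lift x (xO : x \in O) : exists x' : vring w, val x' = x.
Proof. by exists (Sub x xO). Qed.

Lemma resB x y : x \in O -> y \in O -> res (x - y) = res x - res y.
Proof.
by move=> /integral_lift[x' <-] /integral_lift[y' <-]; rewrite -rmorphB !res_val rmorphB.
Qed.

Lemma resX x n : x \in O -> res (x ^+ n) = res x ^+ n.
Proof. by move=> /integral_lift[x' <-]; rewrite -rmorphXn !res_val rmorphXn. Qed.

Lemma res1 : res 1 = 1.
Proof. by rewrite -(rmorph1 (val : vring w -> F)) res_val rmorph1. Qed.

Lemma res_eq0 x : x \in O -> (res x == 0) = ~~ ole (w x) (Some 0).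
Proof. by move=> /integral_lift[x' <-]; rewrite res_val residue_eq0. Qed.

Lemma res_neq0_val x : x \in O -> (res x != 0) = (w x == Some 0).
Proof.
move=> xO; rewrite res_eq0 // negbK; move: xO; rewrite unfold_in /vring_pred.
case: (w x) => [g|] //= g0; apply/idP/eqP => [g0'|[->]] //=.
by congr Some; apply/Order.POrderTheory.le_anti/andP.
Qed.

Lemma polyO_lift (P : {poly F}) : P \is a polyOver O ->
  exists P' : {poly vring w}, P = map_poly val P'.
Proof.
move=> PO; exists (map_poly (insubd (0 : vring w)) P).
apply/polyP => i; rewrite coef_map /= coef_map_id0; last first.
  by apply: val_inj; rewrite val_insubd rpred0 rmorph0.
by rewrite val_insubd (polyOverP PO).
Qed.

Lemma res_horner (P : {poly F}) x : P \is a polyOver O -> x \in O ->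
  P.[x] \in O /\ res P.[x] = (map_poly res P).[res x].
Proof.
move=> /polyO_lift[P' ->] /integral_lift[x' <-]; rewrite horner_map; split; first exact: valP.
rewrite !res_val -horner_map; congr horner.
apply/polyP => i; rewrite coef_map coef_map_id0 ?coef_map ?res_val //=.
by rewrite -(rmorph0 (val : vring w -> F)) res_val rmorph0.
Qed.

Lemma res0 : res 0 = 0.
Proof. by rewrite -(rmorph0 (val : vring w -> F)) res_val rmorph0. Qed.

(** The reduction of P has degree less than its number of distinct roots. *)
Lemma res_roots_coef0 (P : {poly F}) (rs : seq F) i :
  P \is a polyOver O -> {subset rs <= O} -> uniq (map res rs) ->
  (size P <= size rs)%N -> (forall x, x \in rs -> res P.[x] = 0) ->
  res P`_i = 0.
Proof.
move=> PO rsO urs sP P0.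
have Q0 : map_poly res P = 0.
  apply: (@roots_geq_poly_eq0 _ _ (map res rs)) => //.
    apply/allP => _ /mapP[x xrs ->].
    by rewrite rootE -(res_horner PO (rsO x xrs)).2 P0.
  by rewrite size_map (leq_trans _ sP) // size_poly.
by have := congr1 (fun Q : {poly _} => Q`_i) Q0; rewrite coef_map_id0 ?res0 // coef0.
Qed.

Lemma min_coef (P : {poly F}) : exists i, forall j, ole (w P`_i) (w P`_j).
Proof.
suff [i iP] : exists i, forall j, (j < size P)%N -> ole (w P`_i) (w P`_j).
  exists i => j; have [/iP //|] := ltnP j (size P).
  by move=> sj; rewrite (nth_default _ sj) vval0; case: (w _).
elim: (size P) => [|n [i iP]]; first by exists 0%N.
case/orP: (ole_total (w P`_i) (w P`_n)) => le.
  by exists i => j; rewrite ltnS leq_eqVlt => /orP[/eqP-> //|/iP].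
exists n => j; rewrite ltnS leq_eqVlt => /orP[/eqP->|/iP]; first exact: ole_refl.
exact: ole_trans.
Qed.

Lemma ole_divr x y : x != 0 -> ole (w x) (w y) -> y / x \in O.
Proof.
move=> x0 xy; rewrite unfold_in /vring_pred.
have := vvalM w (y / x) x; rewrite divfK //.
move: xy; case Ex: (w x) => [g|]; last by move/vval_None/eqP: Ex; rewrite (negPf x0).
case: (w y) => [h|]; case: (w _) => [k|] //= gh [hk].
by have := oag_leD2l (- g) _ _ gh; rewrite addNr hk [k + g]addrC addKr.
Qed.

End Residues.

Lemma resfield_pchar (F : fieldType) (w : valuation F) p :
  p \in [pchar F] -> p \in [pchar (resfield w)].
Proof.
move=> pF; apply: (rmorph_pchar (residue w)).
rewrite inE (pcharf_prime pF) /=; apply/eqP/val_inj.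
by rewrite rmorph_nat rmorph0 (pcharf0 pF).
Qed.

Lemma exprp_inj (F : fieldType) p m : p \in [pchar F] ->
  injective (fun x : F => x ^+ (p ^ m)).
Proof.
move=> pF x y /= xy; apply/eqP; rewrite -subr_eq0.
have pp := pcharf_prime pF.
have : (x - y) ^+ (p ^ m) == 0.
  have pn : [pchar F].-nat (p ^ m)%N.
    by rewrite pnatX; apply/orP; left; rewrite pnatE.
  have := exprDn_pchar (x - y) y pn; rewrite subrK xy => /eqP.
  by rewrite -subr_eq addrN eq_sym.
by rewrite expf_eq0 expn_gt0 prime_gt0.
Qed.

Section Endomorphisms.
Variables (K E : fieldType) (iota : {rmorphism K -> E}).
Variables (v : valuation K) (w : valuation E).
Hypotheses (vuniq : extends_uniquely iota v) (vw : val_extends iota v w).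
Local Notation O := (vring_pred w).

Definition endo_over (s : {rmorphism E -> E}) := forall k, s (iota k) = iota k.

(** The composite of w with s is another valuation of E extending v. *)
Lemma endo_val s : endo_over s -> val_equiv w (w \o s).
Proof.
move=> sK.
have None_s x : (w \o s) x = None <-> x = 0.
  rewrite /= vval_None; split=> [/eqP|->]; last exact: rmorph0.
  by rewrite fmorph_eq0 => /eqP.
have sM x y : (w \o s) (x * y) = oadd ((w \o s) x) ((w \o s) y).
  by rewrite /= rmorphM vvalM.
have sD x y : ole (omin ((w \o s) x) ((w \o s) y)) ((w \o s) (x + y)).
  by rewrite /= rmorphD vvalD.
apply: (vuniq.2 w (Valuation None_s sM sD)) => // x y.
by rewrite /= !sK; exact: vw.
Qed.

Lemma endo_O s x : endo_over s -> (s x \in O) = (x \in O).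
Proof.
move=> sK; have := endo_val sK 1 x.
by rewrite /= rmorph1 !unfold_in /vring_pred vval1 => ->.
Qed.

Lemma endo_res0 s x : endo_over s -> x \in O -> res w x = 0 -> res w (s x) = 0.
Proof.
move=> sK xO /eqP; rewrite res_eq0 // => x0; apply/eqP.
rewrite res_eq0 ?endo_O //; have := endo_val sK x 1.
by rewrite /= rmorph1 vval1 => <-.
Qed.

Lemma endo_res s x y : endo_over s -> x \in O -> y \in O ->
  res w x = res w y -> res w (s x) = res w (s y).
Proof.
move=> sK xO yO xy; apply/eqP; rewrite -subr_eq0 -resB ?endo_O // -rmorphB.
by apply/eqP/endo_res0 => //; rewrite ?rpredB // resB // xy subrr.
Qed.

(** Some power of the residue of u with exponent p ^ m comes from K and is
    therefore fixed by s; the Frobenius map of the residue field is injective. *)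
Lemma purely_wild_endo_res p (L : divringClosed E) s u :
  p \in [pchar E] -> purely_wild iota p w L -> endo_over s ->
  u \in L -> u \in O -> res w (s u) = res w u.
Proof.
move=> pE [_ _ Lres] sK uL uO.
have [|m [x xK um]] := Lres (res w u).
  by case: (integral_lift uO) uL => u' <- uL; exists u'; rewrite ?res_val.
have sx : s (val x) = val x by move: xK => /asboolP[k ->]; exact: sK.
apply: (exprp_inj (m := m) (resfield_pchar w pE)) => /=.
have {}um : res w (u ^+ (p ^ m)) = res w (val x) by rewrite resX // um res_val.
rewrite -!resX ?endo_O // -rmorphXn (endo_res sK _ _ um) ?rpredX //; last exact: valP.
by rewrite sx um.
Qed.

End Endomorphisms.

(** * Additive polynomials over the valuation ring *)

(** If x were not integral, its inverse would have residue 0 and be a root of the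
    reversed polynomial, whose constant coefficient is a unit. *)
Lemma root_integral (F : fieldType) (w : valuation F) (P : {poly F}) x :
  P \is a polyOver (vring_pred w) -> res w (lead_coef P) != 0 -> root P x ->
  x \in vring_pred w.
Proof.
move=> PO lP Px; apply: contraT => xO; case/negP: (lP).
have x0 : x != 0 by apply: contraNneq xO => ->; rewrite rpred0.
have yO : x^-1 \in vring_pred w.
  rewrite -div1r; apply: ole_divr => //; rewrite vval1.
  by move: xO; rewrite unfold_in /vring_pred; case/orP: (ole_total (w x) (Some 0)) => ->.
have y0 : res w x^-1 = 0.
  apply: contraNeq xO; rewrite res_neq0_val // unfold_in /vring_pred => /eqP y0.
  have := vvalM w x x^-1; rewrite divff // vval1 y0.
  by case: (w x) => [g|] //= [/esym]; rewrite addr0 => ->.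
have P0 : P != 0 by apply: contraNneq lP => ->; rewrite lead_coef0 res0.
pose m := (size P).-1; have sP : size P = m.+1 by rewrite prednK // size_poly_gt0.
(* The reversed polynomial of P. *)
pose Q := \poly_(i < m.+1) P`_(m - i).
have QO : Q \is a polyOver (vring_pred w).
  by apply/polyOverP => i; rewrite coef_poly; case: ifP => _; rewrite ?rpred0 ?(polyOverP PO).
have Qy : Q.[x^-1] = 0.
  have e : x ^+ m * Q.[x^-1] = P.[x].
    rewrite horner_poly horner_coef sP mulr_sumr (reindex_inj rev_ord_inj) /=.
    apply: eq_bigr => i _; rewrite subSS subKn; last by rewrite -ltnS.
    rewrite mulrCA; congr (_ * _).
    rewrite -{1}(@subnK i m) -1?ltnS // exprD [_ * x ^+ i]mulrC -mulrA exprVn.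
    by rewrite divff ?mulr1 // expf_neq0.
  by apply/eqP; move/eqP: e; rewrite (rootP Px) mulf_eq0 expf_eq0 (negPf x0) andbF.
have [_] := res_horner QO yO; rewrite Qy res0 y0 horner_coef0.
by rewrite coef_map_id0 ?res0 // coef_poly subn0 /lead_coef => <-.
Qed.

Section Additive.
Variables (K E : fieldType) (iota : {rmorphism K -> E}).
Variables (v : valuation K) (w : valuation E).
Hypotheses (vw : val_extends iota v w).
Local Notation O := (vring_pred w).

Lemma iota_O x : (iota x \in O) = (x \in vring_pred v).
Proof.
by have := vw 1 x; rewrite /= rmorph1 !unfold_in /vring_pred !vval1 => ->.
Qed.

Lemma iota_res0 x : x \in vring_pred v -> (res w (iota x) == 0) = (res v x == 0).
Proof.
move=> xO; rewrite !res_eq0 ?iota_O //.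
by have := vw x 1; rewrite /= rmorph1 !vval1 => ->.
Qed.

Variables (p n : nat) (a : 'I_n.+1 -> vring v).
Hypotheses (pK : p \in [pchar K]).
Hypotheses (a_first : v (val (a ord0)) = Some 0) (a_last : v (val (a ord_max)) = Some 0).

Definition add_poly_over : {poly E} :=
  map_poly iota (map_poly (val : vring v -> K) (additive_poly p a)).
Local Notation A := add_poly_over.
Local Notation b i := (iota (val (a i))).

Lemma add_poly_overE : A = \sum_(i < n.+1) b i *: 'X^(p ^ i).
Proof.
apply/polyP => j; rewrite !coef_map_id0 ?rmorph0 // !coef_sum !rmorph_sum.
apply: eq_bigr => i _; rewrite !coefZ !coefXn.
by case: eqP => _; rewrite ?mulr1 ?mulr0 ?rmorph0.
Qed.

Let pE : p \in [pchar E]. Proof. by rewrite (fmorph_pchar iota). Qed.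
Let pp : prime p. Proof. exact: pcharf_prime pK. Qed.

Lemma horner_add_poly x : A.[x] = \sum_(i < n.+1) b i * x ^+ (p ^ i).
Proof.
by rewrite add_poly_overE horner_sum; apply: eq_bigr => i _; rewrite hornerZ hornerXn.
Qed.

Lemma add_polyD x y : A.[x + y] = A.[x] + A.[y].
Proof.
rewrite !horner_add_poly -big_split; apply: eq_bigr => i _ /=.
rewrite -mulrDr; congr (_ * _); apply: exprDn_pchar.
by rewrite pnatX; apply/orP; left; rewrite pnatE.
Qed.

Lemma add_polyB x y : A.[x - y] = A.[x] - A.[y].
Proof. by apply: (addIr A.[y]); rewrite -add_polyD !subrK. Qed.

Lemma deriv_add_poly : A^`() = (b ord0)%:P.
Proof.
rewrite add_poly_overE raddf_sum /= big_ord_recl big1 ?addr0 => [|i _].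
  by rewrite derivZ expn0 derivX alg_polyC.
rewrite derivZ derivXn -scaler_nat natrX (pcharf0 pE) /= /bump /= expr0n /=.
by rewrite scale0r scaler0.
Qed.

Let b_O i : b i \in O. Proof. by rewrite iota_O; exact: valP. Qed.

Let b_res i : v (val (a i)) = Some 0 -> res w (b i) != 0.
Proof. by move=> ai; rewrite iota_res0 ?res_neq0_val ?ai //; exact: valP. Qed.

Lemma add_poly_O : A \is a polyOver O.
Proof.
by rewrite add_poly_overE rpred_sum // => i _; rewrite polyOverZ ?polyOverXn.
Qed.

Lemma size_add_poly : size A = (p ^ n).+1.
Proof.
have bn0 : b ord_max != 0 by apply: contraTneq (b_res a_last) => ->; rewrite res0 eqxx.
rewrite add_poly_overE big_ord_recr /= addrC size_polyDl size_scale ?size_polyXn //.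
rewrite ltnS (leq_trans (size_sum _ _ _)) //; apply/bigmax_leqP => i _.
by rewrite (leq_trans (size_scale_leq _ _)) // size_polyXn ltn_exp2l // prime_gt1.
Qed.

Lemma lead_coef_add_poly : lead_coef A = b ord_max.
Proof.
rewrite /lead_coef size_add_poly add_poly_overE coef_sum big_ord_recr /=.
rewrite big1 ?add0r => [|i _]; rewrite coefZ coefXn ?eqxx ?mulr1 //.
by rewrite gtn_eqF ?mulr0 // ltn_exp2l // prime_gt1.
Qed.

(** Reducing A modulo the maximal ideal gives a polynomial with constant nonzero derivative, so
    no two of its roots collide in the residue field; by additivity it is enough to
    look at the collisions with 0. *)
Lemma add_poly_res_inj x y : x \in O -> y \in O ->
  A.[x] = A.[y] -> res w x = res w y -> x = y.
Proof.
move=> xO yO Axy xy; apply/eqP; rewrite -subr_eq0.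
have zO : x - y \in O by rewrite rpredB.
have z0 : res w (x - y) = 0 by rewrite resB // xy subrr.
(* A.[z] = z * B.[z], and B.[z] has the residue of the unit a_0. *)
have /eqP : A.[x - y] = 0 by rewrite add_polyB Axy subrr.
set z := x - y in zO z0 *; pose B := \sum_(i < n.+1) b i *: 'X ^+ (p ^ i).-1.
have -> : A.[z] = z * B.[z].
  rewrite horner_add_poly horner_sum mulr_sumr; apply: eq_bigr => i _.
  by rewrite hornerZ hornerXn mulrCA -exprS prednK // expn_gt0 prime_gt0.
have BO : B \is a polyOver O by rewrite rpred_sum // => i _; rewrite polyOverZ ?polyOverXn.
rewrite mulf_eq0 => /orP[//|/eqP Bz].
have := b_res a_first; have [_] := res_horner BO zO; rewrite Bz res0 z0 horner_coef0.
rewrite coef_map_id0 ?res0 // coef_sum big_ord_recl big1 /= => [|i _].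
  by rewrite coefZ ?expr0 ?coef1 /= mulr1 addr0 => <-; rewrite eqxx.
have : (1 < p ^ bump 0 i)%N by rewrite -{1}(expn0 p) ltn_exp2l // prime_gt1.
by rewrite coefZ coefXn; case: (p ^ _)%N => [|[|k]] // _; rewrite mulr0.
Qed.

Definition shifted_poly (d : K) : {poly K} :=
  map_poly (val : vring v -> K) (additive_poly p a) - d%:P.

Lemma map_shifted_poly d : map_poly iota (shifted_poly d) = A - (iota d)%:P.
Proof. by rewrite rmorphB /= (map_polyC iota). Qed.

Lemma root_shifted_poly d x : root (map_poly iota (shifted_poly d)) x = (A.[x] == iota d).
Proof. by rewrite rootE map_shifted_poly hornerD hornerN hornerC subr_eq0. Qed.

Lemma shifted_root_O d x : d \in vring_pred v -> A.[x] = iota d -> x \in O.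
Proof.
move=> dO Ax; apply: (@root_integral _ _ (A - (iota d)%:P)).
- by rewrite rpredB ?add_poly_O ?polyOverC ?iota_O.
- rewrite lead_coefDl ?lead_coef_add_poly ?b_res // size_polyN size_add_poly.
  by rewrite (leq_ltn_trans (size_polyC_leq1 _)) // ltnS expn_gt0 prime_gt0.
- by rewrite rootE hornerD hornerN hornerC Ax subrr.
Qed.

Lemma separable_shifted_poly d : separable_poly (map_poly iota (shifted_poly d)).
Proof.
rewrite unlock map_shifted_poly derivB derivC subr0 deriv_add_poly -(alg_polyC (b ord0)).
rewrite coprimepZr ?coprimep1 //.
by apply: contraTneq (b_res a_first) => ->; rewrite res0 eqxx.
Qed.

End Additive.

(** * Simple extensions inside an algebraic extension *)

Section Adjunction.
Variables (K E : fieldType) (iota : {rmorphism K -> E}).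
Implicit Types (L M : divringClosed E) (t : E).

Lemma base_sub_adjoin t : {subset base_field iota <= adjoin iota t}.
Proof. by move=> x xK; apply/asboolP => M KM _; exact: KM. Qed.

Lemma mem_adjoin t : t \in adjoin iota t.
Proof. exact/asboolP. Qed.

Lemma adjoin_sub t M : {subset base_field iota <= M} -> t \in M ->
  {subset adjoin iota t <= M}.
Proof. by move=> KM tM x /asboolP; apply. Qed.

Lemma mem_base k : iota k \in base_field iota.
Proof. by apply/asboolP; exists k. Qed.

Lemma endo_fix_adjoin (s : {rmorphism E -> E}) t x :
  endo_over iota s -> s t = t -> x \in adjoin iota t -> s x = x.
Proof.
move=> sK st xt; have [|y z|y z|M MP] := @divring_of_prop E (fun y => s y = y).
- exact: rmorph1.
- by move=> sy sz; rewrite rmorphB sy sz.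
- by move=> sy sz; rewrite fmorph_div sy sz.
apply/MP; apply: (adjoin_sub (M := M)) xt; last exact/MP.
by move=> _ /asboolP[k ->]; apply/MP.
Qed.

Hypothesis alg : algebraic_ext iota.

(** Because E is algebraic over K, polynomial expressions in t already form a field:
    the inverse of a nonzero y is a polynomial in y. *)
Lemma adjoin_horner L t y : {subset base_field iota <= L} ->
  (forall M, {subset L <= M} -> t \in M -> y \in M) ->
  exists2 U : {poly E}, U \is a polyOver L & y = U.[t].
Proof.
move=> KL yP.
pose D z := exists2 U : {poly E}, U \is a polyOver L & z = U.[t].
have LK (r : {poly K}) : map_poly iota r \is a polyOver L.
  by apply/polyOverP => i; rewrite coef_map; apply/KL/mem_base.
have DV z : D z -> D z^-1.
  case=> U UL zU; have [z0|z0] := eqVneq z 0.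
    by exists 0; rewrite ?rpred0 // z0 invr0 horner0.
  have [q qmin] := is_minpoly_exists (alg z).
  have [|r [s rs]] := @is_minpoly_bezout _ _ _ _ _ 'X qmin.
    by rewrite map_polyX hornerX.
  exists (map_poly iota r \Po U); first exact: polyOver_comp.
  rewrite horner_comp -zU; apply: (mulIf z0); rewrite mulVf //.
  have /(congr1 (fun p => (map_poly iota p).[z])) := rs.
  rewrite rmorphD !rmorphM rmorph1 /= map_polyX hornerD !hornerM hornerX hornerC.
  have /rootP -> : root (map_poly iota q) z by rewrite qmin.2.
  by rewrite mulr0 addr0.
have [|x z|x z|M MP] := @divring_of_prop E D.
- by exists 1; rewrite ?rpred1 // hornerC.
- by case=> U UL -> [V VL ->]; exists (U - V); rewrite ?rpredB // hornerD hornerN.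
- case=> U UL -> /DV[V VL ->]; exists (U * V); rewrite ?rpredM // hornerM //.
apply/MP/yP; last by apply/MP; exists 'X; rewrite ?polyOverX ?hornerX.
by move=> x xL; apply/MP; exists x%:P; rewrite ?polyOverC ?hornerC.
Qed.

(** Since g has coefficients in K, the powers of t are already combinations over K of
    the first ones; no division over L is needed. *)
Lemma horner_reduce L t (g : {poly K}) (U : {poly E}) :
  {subset base_field iota <= L} -> g != 0 -> root (map_poly iota g) t ->
  U \is a polyOver L ->
  exists V : {poly E}, [/\ V \is a polyOver L, (size V < size g)%N & V.[t] = U.[t]].
Proof.
move=> KL g0 gt UL.
exists (\sum_(i < size U) U`_i *: map_poly iota ('X^i %% g)); split.
- rewrite rpred_sum // => i _; apply: polyOverZ; first exact: (polyOverP UL).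
  by apply/polyOverP => j; rewrite coef_map; apply/KL/mem_base.
- rewrite -[size g]prednK ?size_poly_gt0 // ltnS.
  rewrite (leq_trans (size_sum _ _ _)) //; apply/bigmax_leqP => i _.
  rewrite (leq_trans (size_scale_leq _ _)) // size_map_poly -ltnS.
  by rewrite prednK ?size_poly_gt0 // ltn_modp.
rewrite horner_sum horner_coef; apply: eq_bigr => i _; rewrite hornerZ; congr (_ * _).
have := congr1 (fun p => (map_poly iota p).[t]) (divp_eq 'X^i g).
by rewrite rmorphD rmorphM map_polyXn hornerXn hornerD hornerM (rootP gt) mulr0 add0r => ->.
Qed.

End Adjunction.

Lemma is_minpoly_roots (K : fieldType) (E : closedFieldType)
    (iota : {rmorphism K -> E}) (t : E) (g q : {poly K}) :
  is_minpoly iota t g -> root (map_poly iota q) t ->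
  separable_poly (map_poly iota q) ->
  exists rs : seq E, [/\ uniq rs, size g = (size rs).+1, t \in rs,
    {in rs, forall x, root (map_poly iota g) x}
  & {in rs, forall x, root (map_poly iota q) x}].
Proof.
move=> [g0 gP] qt sq; have gq : map_poly iota g %| map_poly iota q.
  by rewrite dvdp_map -gP.
have [rs gE] := closed_field_poly_normal (map_poly iota g).
have lg : lead_coef (map_poly iota g) != 0 by rewrite lead_coef_eq0 map_poly_eq0.
have rsP x : root (map_poly iota g) x = (x \in rs) by rewrite gE rootZ // root_prod_XsubC.
exists rs; split=> [|||x|x].
- rewrite -(separable_prod_XsubC rs); apply: dvdp_separable (dvdp_separable gq sq).
  by rewrite gE dvdpZr.
- by rewrite -(size_map_poly iota) gE size_scale // size_prod_XsubC.
- by rewrite -rsP gP.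
- by rewrite rsP.
- by rewrite -rsP -!dvdp_XsubCl => xg; exact: dvdp_trans xg gq.
Qed.

(** * Purely wild extensions and roots of A - d *)

Section Twist.
Variables (K : fieldType) (E : closedFieldType) (iota : {rmorphism K -> E}).
Variables (v : valuation K) (w : valuation E) (p n : nat) (a : 'I_n.+1 -> vring v).
Hypotheses (alg : algebraic_ext iota) (vuniq : extends_uniquely iota v).
Hypotheses (vw : val_extends iota v w) (pK : p \in [pchar K]).
Hypotheses (a_first : v (val (a ord0)) = Some 0) (a_last : v (val (a ord_max)) = Some 0).
Local Notation O := (vring_pred w).
Local Notation A := (add_poly_over iota p a).

Let pE : p \in [pchar E]. Proof. by rewrite (fmorph_pchar iota). Qed.

Section Root.
Variables (d : K) (xi : E) (g : {poly K}) (rs : seq E).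
Hypotheses (dO : d \in vring_pred v) (xi_rs : xi \in rs).
Hypotheses (gmin : is_minpoly iota xi g) (g_size : size g = (size rs).+1).
Hypotheses (rs_uniq : uniq rs) (rs_g : {in rs, forall x, root (map_poly iota g) x}).
Hypotheses (rs_A : {in rs, forall x, A.[x] = iota d}).

Let rs_O : {subset rs <= O}.
Proof. by move=> x /rs_A; exact: (shifted_root_O vw pK a_last dO). Qed.

Let rs_res : uniq (map (res w) rs).
Proof.
rewrite map_inj_in_uniq // => x y xrs yrs.
by apply: (add_poly_res_inj vw pK a_first); rewrite ?rs_O ?rs_A.
Qed.

Lemma conjugate_root x : x \in rs -> exists2 s, endo_over iota s & s xi = x.
Proof.
move=> /rs_g gx; have [|s [_ sK sx]] := conjugate_endo alg _ gmin gx.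
  by move=> k; exists k.
by exists s.
Qed.

(** An endomorphism over K moves the coefficients of U, which lie in a purely wild
    extension, only within their residue classes. *)
Lemma res_endo_horner (L : divringClosed E) s (U : {poly E}) x :
  purely_wild iota p w L -> endo_over iota s ->
  U \is a polyOver L -> U \is a polyOver O -> x \in O ->
  res w (s U.[x]) = res w U.[s x].
Proof.
move=> LW sK UL UO xO; rewrite -horner_map.
have sxO : s x \in O by rewrite (endo_O vuniq vw).
have sUO : map_poly s U \is a polyOver O.
  by apply/polyOverP => i; rewrite coef_map (endo_O vuniq vw) // (polyOverP UO).
rewrite (res_horner sUO sxO).2 (res_horner UO sxO).2; congr horner.
apply/polyP => i; rewrite !coef_map_id0 ?res0 ?rmorph0 //.
by apply: (purely_wild_endo_res vuniq vw pE LW); rewrite ?(polyOverP UL) ?(polyOverP UO).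
Qed.

(** This is the defectless, unramified behaviour of xi, over any purely wild L
    at once.  After scaling, some coefficient of U has residue 1; if U.[xi] were
    in the maximal ideal, so would be U.[x] for all conjugates x of xi, and the
    residues of these are too many roots for the reduction of U. *)
Lemma val_horner (L : divringClosed E) (U : {poly E}) :
  purely_wild iota p w L -> U \is a polyOver L -> (size U <= size rs)%N ->
  exists i, w U.[xi] = w U`_i /\ forall j, ole (w U`_i) (w U`_j).
Proof.
move=> LW UL sU; have [i imin] := min_coef w U.
exists i; split=> //; have [Ui0|Ui0] := eqVneq U`_i 0.
  suff -> : U = 0 by rewrite horner0 coef0.
  apply/polyP => j; rewrite coef0; apply/(vval_None w).
  by have := imin j; rewrite Ui0 vval0; case: (w _).
pose V := (U`_i)^-1 *: U.
have VO : V \is a polyOver O.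
  by apply/polyOverP => j; rewrite coefZ mulrC; apply: ole_divr.
have VL : V \is a polyOver L by rewrite polyOverZ // rpredV (polyOverP UL).
have Vi : V`_i = 1 by rewrite coefZ mulVf.
have [VxO _] := res_horner VO (rs_O xi_rs).
have /eqP Vx : w V.[xi] == Some 0.
  rewrite -res_neq0_val //; apply/eqP => V0.
  have /eqP : res w V`_i = 0.
    apply: (res_roots_coef0 i VO rs_O rs_res).
      by rewrite (leq_trans (size_scale_leq _ _)).
    move=> x /conjugate_root[s sK <-].
    by rewrite -(res_endo_horner LW) ?rs_O // (endo_res0 vuniq vw).
  by rewrite Vi res1 oner_eq0.
have -> : U = U`_i *: V by rewrite scalerA divff // scale1r.
rewrite hornerZ vvalM Vx coefZ Vi mulr1.
by case: (w _) => [h|] //=; rewrite addr0.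
Qed.

Variables (theta : E) (c : K).
Hypotheses (theta_pw : purely_wild iota p w (adjoin iota theta)).
Hypotheses (theta_min : is_minpoly iota theta (shifted_poly p a c)).

(** By additivity theta + xi - x is a conjugate of theta, and xi has the same
    degree over K(theta) as over K; so xi can be moved to x while theta moves
    by the opposite amount. *)
Lemma compensating_endo x : x \in rs ->
  exists s, [/\ endo_over iota s, s (theta + xi) = theta + xi & s xi = x].
Proof.
move=> xrs; pose L : divringClosed E := adjoin iota theta.
have KL k : iota k \in L by exact/base_sub_adjoin/mem_base.
have At : A.[theta] = iota c.
  by apply/eqP; rewrite -root_shifted_poly theta_min.2.
have [||s1 [_ s1K s1t]] := conjugate_endo (t' := theta + xi - x) (psi := iota) alg _ theta_min.
- by move=> k; exists k.
- rewrite root_shifted_poly (add_polyB _ _ pK) (add_polyD _ _ pK) At !rs_A //.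
  by rewrite addrK.
pose emb : K -> subfield_type L := fun k => Sub (iota k) (KL k).
have emb0 : emb 0 = 0 by apply: val_inj; rewrite /= rmorph0.
pose gL : {poly subfield_type L} := map_poly emb g.
pose psi : {rmorphism subfield_type L -> E} := s1 \o val.
have gLE : map_poly val gL = map_poly iota g.
  by apply/polyP => i; rewrite !coef_map_id0 ?rmorph0.
have gLs : map_poly psi gL = map_poly iota g.
  by apply/polyP => i; rewrite !coef_map_id0 ?rmorph0 //=; exact: s1K.
have sgL : size gL = (size rs).+1 by rewrite -g_size -(size_map_poly iota) -gLE size_map_poly.
have gL0 : gL != 0 by rewrite -size_poly_gt0 sgL.
have gLxi : root (map_poly val gL) xi by rewrite gLE rs_g.
(* By val_horner over K(theta), no nonzero polynomial of smaller degree over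
   K(theta) vanishes at xi. *)
have gLmin : is_minpoly (val : {rmorphism subfield_type L -> E}) xi gL.
  split=> // P; apply/idP/idP => [Pxi|/dvdpP[Q ->]]; last by rewrite rmorphM rootM gLxi orbT.
  have [] := @val_horner L (map_poly val (P %% gL)) theta_pw.
  - by apply/polyOverP => i; rewrite coef_map; exact: valP.
  - by rewrite size_map_poly -ltnS -sgL ltn_modp.
  move=> i [e imin].
  have : (map_poly val (P %% gL)).[xi] = 0.
    have := rootP Pxi; rewrite {1}(divp_eq P gL) rmorphD rmorphM hornerD hornerM.
    by rewrite (rootP gLxi) mulr0 add0r.
  move=> P0; rewrite /dvdp; apply/eqP/polyP => j; rewrite coef0; apply: val_inj.
  rewrite rmorph0; apply/(vval_None w).
  by have := imin j; rewrite -e P0 vval0 coef_map; case: (w _).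
have [||s [sL sK sxi]] := conjugate_endo (t' := x) (psi := psi) alg _ gLmin.
- by move=> k; exists (emb k) => //=; exact: s1K.
- by rewrite gLs rs_g.
exists s; split=> //; have := sL (Sub theta (mem_adjoin iota theta)).
by rewrite /= s1t rmorphD sxi => ->; rewrite subrK.
Qed.

(** Write an element of K(theta + xi) as U.[xi] with U over K(theta).  Its value is
    that of a coefficient.  If it is integral, it is fixed by the endomorphisms
    above, so the reduction of U takes the same value at all
    the conjugates of xi; it is therefore constant, and the residue is that of
    the constant coefficient. *)
Lemma purely_wild_twist : purely_wild iota p w (adjoin iota (theta + xi)).
Proof.
have KL : {subset base_field iota <= adjoin iota theta} by exact: base_sub_adjoin.
have expand y : y \in adjoin iota (theta + xi) ->
    exists U : {poly E}, [/\ U \is a polyOver (adjoin iota theta),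
      (size U <= size rs)%N & y = U.[xi]].
  move=> yL; have [|U UL ->] := adjoin_horner (t := xi) (y := y) alg KL.
    move=> M LM xiM; apply: adjoin_sub yL; first by move=> z /KL/LM.
    by rewrite rpredD // LM // mem_adjoin.
  have [V [VL sV <-]] := horner_reduce KL gmin.1 (rs_g xi_rs) UL.
  by exists V; split=> //; rewrite -ltnS -g_size.
split; first exact: base_sub_adjoin.
  move=> h [y /expand[U [UL sU ->]]].
  have [i [-> _]] := val_horner theta_pw UL sU.
  by move=> Uih; case: theta_pw => _ + _; apply; exists U`_i; rewrite ?(polyOverP UL).
move=> z [y yL ->].
have [U [UL sU yU]] := expand _ yL.
have [i [wU imin]] := val_horner theta_pw UL sU.
have yO : val y \in O by exact: valP.
have UO : U \is a polyOver O.
  apply/polyOverP => j; move: yO; rewrite yU unfold_in /vring_pred wU => yO.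
  by apply: ole_trans yO (imin j).
have U0O : U`_0 \in O by rewrite (polyOverP UO).
suff /eqP yU0 : res w (U - (val y)%:P)`_0 == 0.
  case: theta_pw => _ _; apply; have [u uE] := integral_lift U0O.
  exists u; first by rewrite uE (polyOverP UL).
  rewrite -!res_val uE; apply/eqP; rewrite eq_sym -subr_eq0 -resB //.
  by move: yU0; rewrite coefB coefC => ->.
apply/eqP; apply: (@res_roots_coef0 _ w (U - (val y)%:P) rs 0) => //.
- by rewrite rpredB // polyOverC.
- rewrite (leq_trans (size_polyD _ _)) // geq_max sU size_polyN.
  by rewrite (leq_trans (size_polyC_leq1 _)) //; case: rs xi_rs.
move=> x /compensating_endo[s [sK st <-]].
have xiO := rs_O xi_rs.
rewrite hornerD hornerN hornerC resB //; last first.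
  by have [] := res_horner UO (x := s xi); rewrite // (endo_O vuniq vw).
rewrite -(res_endo_horner theta_pw) // -yU.
by rewrite (endo_fix_adjoin sK st yL) subrr.
Qed.

End Root.

(** A root of A - d inside a purely wild extension is congruent to all its
    conjugates, and hence equal to them, so it lies in K; then A - d has a root
    in the residue field of K. *)
Lemma purely_wild_root (L : divringClosed E) (d : vring v) xi :
  purely_wild iota p w L -> xi \in L -> A.[xi] = iota (val d) ->
  exists x, (map_poly (residue v) (additive_poly p a)).[x] = residue v d.
Proof.
move=> LW xiL Axi; have dO : val d \in vring_pred v by exact: valP.
have rE x : root (map_poly iota (shifted_poly p a (val d))) x = (A.[x] == iota (val d)).
  exact: root_shifted_poly.
have [g gmin] := is_minpoly_exists (alg xi).
have [|rs [urs gsz xirs rs_g rs_q]] := is_minpoly_roots gmin _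
    (separable_shifted_poly vw pK a_first (val d)).
  by rewrite rE Axi.
have rs_A : {in rs, forall x, A.[x] = iota (val d)}.
  by move=> x /rs_q; rewrite rE => /eqP.
have rsO x : x \in rs -> x \in O by move=> /rs_A/(shifted_root_O vw pK a_last dO).
have all_xi x : x \in rs -> x = xi.
  move=> xrs; have [s sK sx] := conjugate_root gmin rs_g xrs.
  apply: (add_poly_res_inj vw pK a_first); rewrite ?rsO ?rs_A // -sx.
  by apply: (purely_wild_endo_res vuniq vw pE LW sK xiL); exact: rsO.
(* The minimal polynomial of xi is separable with xi as its only root. *)
have rs1 : size rs = 1%N.
  case: rs urs xirs all_xi {gsz rs_g rs_q rs_A rsO} => [|y [|z rs]] //= + _ all_xi.
  by rewrite inE (all_xi y) ?mem_head // (all_xi z) ?inE ?eqxx ?orbT.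
have [k xik] : exists k, xi = iota k.
  have g1 : g`_1 != 0.
    by have := gmin.1; rewrite -lead_coef_eq0 /lead_coef gsz rs1.
  exists (- (g`_0 / g`_1)); have := rootP (rs_g _ xirs).
  rewrite horner_coef size_map_poly gsz rs1 big_ord_recl big_ord1 /= !coef_map expr0 expr1 mulr1.
  move/eqP; rewrite addrC addr_eq0 => /eqP e.
  by rewrite rmorphN fmorph_div -mulNr -e mulrAC divff ?mul1r // fmorph_eq0.
have kO : k \in vring_pred v by rewrite -(iota_O vw) -xik rsO.
have [k' k'E] := integral_lift kO.
have k'root : (map_poly val (additive_poly p a)).[val k'] = val d.
  by apply: (fmorph_inj iota); rewrite k'E -Axi xik -horner_map.
exists (residue v k'); rewrite horner_map; congr residue; apply: val_inj.
by rewrite -k'root horner_map.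
Qed.

End Twist.

(** * Maximal purely wild extensions *)

(** All conditions in the definition of a purely wild extension speak of one
    element at a time, so they pass to unions of chains. *)
Lemma purely_wild_maximal (K E : fieldType) (iota : {rmorphism K -> E}) p
    (w : valuation E) (L0 : divringClosed E) :
  purely_wild iota p w L0 ->
  exists L, maximal_purely_wild iota p w L /\ {subset L0 <= L}.
Proof.
move=> W0; pose P (X : set E) := exists L : divringClosed E,
  purely_wild iota p w L /\ forall x, X x <-> x \in L.
have [||M [[L [LW LM]] L0M maxM]] := @Zorn_above E P (fun x => x \in L0).
- by exists L0.
- move=> F [X0 FX0] FP FL0 Ftot.
  have join x y : (exists2 X, F X & X x) -> (exists2 X, F X & X y) ->
      exists X, [/\ F X, X x & X y].
    move=> [X FX Xx] [Y FY Yy]; case: (Ftot X Y FX FY) => XY.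
      by exists Y; split=> //; exact: XY.
    by exists X; split=> //; exact: XY.
  have [|x y|x y|L LU] := @divring_of_prop E (fun x => exists2 X, F X & X x).
  + by exists X0 => //; apply: FL0 => //; exact: rpred1.
  + move=> Fx /(join _ _ Fx)[X [FX Xx Xy]]; exists X => //.
    by have [M [_ XM]] := FP _ FX; apply/XM/rpredB; apply/XM.
  + move=> Fx /(join _ _ Fx)[X [FX Xx Xy]]; exists X => //.
    by have [M [_ XM]] := FP _ FX; apply/XM/rpred_div; apply/XM.
  exists L; split; last by move=> x; split=> /LU.
  split=> [x xK|h [x /LU[X FX Xx] wx]|z [x /LU[X FX Xx] ->]].
  + by apply/LU; exists X0 => //; apply: FL0 => //; case: W0 => + _ _; apply.
  + by have [M [[_ + _] XM]] := FP _ FX; apply; exists x => //; apply/XM.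
  + by have [M [[_ _ +] XM]] := FP _ FX; apply; exists x => //; apply/XM.
exists L; split; last by move=> x /L0M/LM.
split=> // N NW LN x; apply/idP/idP => [xN|/LN //].
apply/LM; apply: (maxM (fun y => y \in N)) xN; first by exists N.
by move=> y /LM/LN.
Qed.

(** The coefficients of A lie in K, so A commutes with isomorphisms over K. *)
Lemma isomorphic_root (K E : fieldType) (iota : {rmorphism K -> E})
    (v : valuation K) (w : valuation E) (p n : nat) (a : 'I_n.+1 -> vring v)
    (L1 L2 : divringClosed E) (c : K) (theta : E) :
  {subset base_field iota <= L1} -> theta \in L1 ->
  (add_poly_over iota p a).[theta] = iota c -> val_isomorphic iota w L1 L2 ->
  exists2 theta', theta' \in L2 & (add_poly_over iota p a).[theta'] = iota c.
Proof.
move=> KL1 tL1 At [sigma [_ sigmaK _]].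
have KL k : iota k \in L1 by exact/KL1/mem_base.
pose u : subfield_type L1 := Sub theta tL1.
pose b i : subfield_type L1 := Sub (iota (val (a i))) (KL _).
have bsum : \sum_(i < n.+1) b i * u ^+ (p ^ i) = Sub (iota c) (KL c).
  apply: val_inj; rewrite -[RHS]At horner_add_poly rmorph_sum.
  by apply: eq_bigr => i _; rewrite rmorphM rmorphXn.
exists (val (sigma u)); first exact: valP.
rewrite -(sigmaK c (Sub (iota c) (KL c))) // -bsum horner_add_poly !rmorph_sum.
apply: eq_bigr => i _; rewrite !rmorphM !rmorphXn; congr (_ * _).
exact/esym/sigmaK.
Qed.

Theorem theorem1p5 (K : fieldType) (v : valuation K) (p : nat)
    (Kac : closedFieldType) (iota : {rmorphism K -> Kac}) (w : valuation Kac)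
    (n : nat) (a : 'I_n.+1 -> vring v) (c : K) (theta : Kac) :
  algebraic_ext iota ->
  henselian v iota ->
  val_extends iota v w ->
  p \in [pchar K] ->
  minimal_purely_wild iota p w (adjoin iota theta) ->
  is_minpoly iota theta
    (map_poly (val : vring v -> K) (additive_poly p a) - c%:P) ->
  v (val (a ord0)) = Some 0 ->
  v (val (a ord_max)) = Some 0 ->
  ~ poly_closed (map_poly (residue v) (additive_poly p a)) ->
  exists L1 L2 : divringClosed Kac,
    [/\ maximal_purely_wild iota p w L1,
        maximal_purely_wild iota p w L2
      & ~ val_isomorphic iota w L1 L2].
Proof.
move=> alg hens vw pK [theta_pw _] theta_min a_first a_last not_closed.
have [d noroot] : exists d : vring v,
    forall x, (map_poly (residue v) (additive_poly p a)).[x] <> residue v d.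
  apply: contrapT => no; apply: not_closed => z; apply: contrapT => nox.
  by apply: no; exists (repr z) => x; rewrite residueP => xz; apply: nox; exists x.
have dO : val d \in vring_pred v by exact: valP.
have fE e x : root (map_poly iota (shifted_poly p a e)) x =
    ((add_poly_over iota p a).[x] == iota e) by exact: root_shifted_poly.
have At : (add_poly_over iota p a).[theta] = iota c.
  by apply/eqP; rewrite -fE theta_min.2.
have /closed_rootP[xi xi_root] : size (map_poly iota (shifted_poly p a (val d))) != 1%N.
  have sA := size_add_poly vw pK a_last.
  have sp : (1 < size (add_poly_over iota p a))%N.
    by rewrite sA ltnS expn_gt0 prime_gt0 // (pcharf_prime pK).
  rewrite map_shifted_poly size_polyDl ?gtn_eqF // size_polyN.
  exact: leq_ltn_trans (size_polyC_leq1 _) sp.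
have Axi : (add_poly_over iota p a).[xi] = iota (val d) by apply/eqP; rewrite -fE.
have [g gmin] := is_minpoly_exists (alg xi).
have [rs [urs gsz xirs rs_g rs_q]] :=
  is_minpoly_roots gmin xi_root (separable_shifted_poly vw pK a_first (val d)).
have rs_A : {in rs, forall x, (add_poly_over iota p a).[x] = iota (val d)}.
  by move=> x /rs_q; rewrite fE => /eqP.
have twist_pw := purely_wild_twist alg hens vw pK a_first a_last dO xirs gmin gsz
  urs rs_g rs_A theta_pw theta_min.
have [L1 [L1max L1t]] := purely_wild_maximal theta_pw.
have [L2 [L2max L2t]] := purely_wild_maximal twist_pw.
exists L1, L2; split=> // iso.
have KL1 : {subset base_field iota <= L1} by case: L1max => [[]].
have [t' t'L2 At'] := isomorphic_root KL1 (L1t _ (mem_adjoin iota theta)) At iso.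
have xi'L2 : theta + xi - t' \in L2 by rewrite rpredB // L2t // mem_adjoin.
have [|x /noroot //] := purely_wild_root (d := d) alg hens vw pK a_first a_last L2max.1 xi'L2.
by rewrite (add_polyB _ _ pK) (add_polyD _ _ pK) At At' addrAC subrr add0r.
Qed.
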